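(* Let $2<p_1,p_2<\infty$, $1/p_1+1/p_2=1/2$, and let $f_1\in\ell^{p_1,\infty}(\mathbb{Z}^d)$ and $f_2\in\ell^{p_2,\infty}(\mathbb{Z}^d)$ be nonnegative sequences. Then the functions $f_1(\nu_1)f_2(\nu_2)$, $f_1(\nu_1+\nu_2)f_2(\nu_2)$, and $f_1(\nu_1)f_2(\nu_1+\nu_2)$ of $(\nu_1,\nu_2)\in\mathbb{Z}^d\times\mathbb{Z}^d$ belong to $\mathcal B(\mathbb{Z}^d\times\mathbb{Z}^d)$.
   Context: $d\in\mathbb{N}$. For a countable set $K$ and $1\le q<\infty$, $\ell^{q,\infty}(K)$ is the set of complex sequences $a=\{a_k\}_{k\in K}$ with $\|a\|_{\ell^{q,\infty}(K)}=\sup_{t>0}\big\{t\,\sharp(\{k\in K:|a_k|>t\})^{1/q}\big\}<\infty$, where $\sharp$ denotes cardinality. $\mathcal B(\mathbb{Z}^d\times\mathbb{Z}^d)$ is the set of nonnegative functions $V$ on $\mathbb{Z}^d\times\mathbb{Z}^d$ for which there is a constant $c\in(0,\infty)$ such that $\sum_{\nu_1,\nu_2\in\mathbb{Z}^d}V(\nu_1,\nu_2)A(\nu_1+\nu_2)B(\nu_1)C(\nu_2)\le c\|A\|_{\ell^2(\mathbb{Z}^d)}\|B\|_{\ell^2(\mathbb{Z}^d)}\|C\|_{\ell^2(\mathbb{Z}^d)}$ for all nonnegative functions $A,B,C$ on $\mathbb{Z}^d$. *)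

(* Defs.v *)
From HB Require Import structures.
From mathcomp Require Import all_boot all_order all_algebra.
From mathcomp Require Import all_classical all_reals all_analysis.

Set Implicit Arguments.
Unset Strict Implicit.
Unset Printing Implicit Defensive.

Import Order.TTheory GRing.Theory Num.Theory.
Local Open Scope classical_set_scope.
Local Open Scope ring_scope.

(* The integer lattice, with the pointwise addition of row vectors. *)
Notation lattice d := 'rV[int]_d.

(* Sequences take values in any [V] with an [R]-valued norm. Both [V := R] and
   the complex numbers with their real modulus ([Rcomplex R] of the
   real-closed library) qualify; for real sequences the norm is the same
   whether they are seen in [R] or in the complex numbers. *)

(* [counting] is [+oo] on infinite sets, and [+oo `^ q^-1 = +oo] for q > 0. *)
Definition weak_ell_norm (R : realType) (V : normedZmodType R) (K : countType)
    (q : R) (a : K -> V) : \bar R :=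
  ereal_sup
    [set (t%:E * counting [set k | (t < `|a k|)%R] `^ q^-1%R)%E
      | t in [set t : R | 0 < t]].

Definition weak_ell (R : realType) (V : normedZmodType R) (K : countType)
    (q : R) : set (K -> V) :=
  [set a | (weak_ell_norm q a < +oo)%E].

Definition ell2_norm (R : realType) (V : normedZmodType R) (K : countType)
    (a : K -> V) : \bar R :=
  ((\esum_(k in [set: K]) (`|a k| ^+ 2)%R%:E) `^ (2^-1)%R)%E.

(* [A], [B], [C] need not be square-summable: norms may be [+oo], and the
   convention [0 * +oo = 0] is harmless because a null norm means a null
   function, for which the left-hand side is 0 too. *)
Definition class_B (R : realType) (d : nat) : set (lattice d * lattice d -> R) :=
  [set W | (forall nu, 0 <= W nu) /\
    exists c : R, 0 < c /\
      forall A B C : lattice d -> R,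
        (forall nu, 0 <= A nu) -> (forall nu, 0 <= B nu) ->
        (forall nu, 0 <= C nu) ->
        (\esum_(nu in [set: lattice d * lattice d])
            (W nu * A (nu.1 + nu.2)%R * B nu.1 * C nu.2)%R%:E
         <= c%:E * ell2_norm A * ell2_norm B * ell2_norm C)%E].

(* Main.v *)
Require Import Defs.
From HB Require Import structures.
From mathcomp Require Import all_boot all_order all_algebra finmap.
From mathcomp Require Import all_classical all_reals all_analysis.
From mathcomp Require Import ring lra.
Import Order.TTheory GRing.Theory Num.Theory.
Local Open Scope classical_set_scope.
Local Open Scope ring_scope.

(** In all three cases the form to bound is a sum, over the pairs
    [nu = (nu1, nu2)], of [f(b) g(c) A(a) B(b) C(c)], where [a], [b], [c] are
    the three maps [nu1], [nu2], [nu1 + nu2] in some order and [f], [g] are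
    [f1], [f2] with exponents [p], [q]. The only property of these maps that
    matters is that any two of them determine the pair, and it is symmetric in
    the three maps; so one abstract inequality, [esum_trilinear], gives the
    three statements.

    To prove it, cut the sum along [g(c)^q <= f(b)^p]. On this region, apply
    Cauchy-Schwarz to the splitting [A(a) B(b)] times [f(b) g(c) C(c)]. The sum
    of the squares of the first factors is at most [|A|^2 |B|^2], because
    [(a, b)] is injective ([sum_sqr_pair]). For the second factors, fix the
    value [z] of [c]: then [b] is injective and
    [f(b) >= t := g(z)^(q/p)], so everything rests on the bound
    [sum_{f >= t} f^2 <= D t^(2-p)], which holds for [f] of weak type [p > 2]
    ([sum_sqr_tail]). As [1/p + 1/q = 1/2], the power [t^(2-p)] is exactly
    [g(z)^(-2)], so the fibre over [z] contributes at most [D C(z)^2]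
    ([sum_sqr_kernel]). The complementary region is the same one with [f] and
    [g] exchanged. This avoids interpolation and Lorentz spaces altogether.

    All estimates are proved for sums over finite sets of pairs, where the
    [l^2] norms are finite, and only then passed to the supremum; infinite
    norms therefore never need a separate discussion. *)

(** * Finite sums *)

Lemma cauchy_schwarz_sum (R : rcfType) (I : Type) (r : seq I) (P : pred I)
    (u v : I -> R) :
  \sum_(i <- r | P i) u i * v i <=
    Num.sqrt (\sum_(i <- r | P i) u i ^+ 2) *
    Num.sqrt (\sum_(i <- r | P i) v i ^+ 2).
Proof.
elim: r => [|i r IHr]; first by rewrite !big_nil sqrtr0 mulr0.
rewrite !big_cons; case: (P i) => //; move: IHr.
set U := \sum_(j <- r | P j) u j ^+ 2; set V := \sum_(j <- r | P j) v j ^+ 2.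
have U0 : 0 <= U by apply: sumr_ge0 => j _; exact: sqr_ge0.
have V0 : 0 <= V by apply: sumr_ge0 => j _; exact: sqr_ge0.
move=> /(lerD (lexx (u i * v i)))/le_trans; apply.
rewrite -[leRHS]sqrtrM ?addr_ge0 ?sqr_ge0//.
apply: le_trans (ler_norm _) _; rewrite -sqrtr_sqr ler_wsqrtr//.
rewrite -{2}(sqr_sqrtr U0) -{2}(sqr_sqrtr V0) -subr_ge0.
set x := Num.sqrt U; set y := Num.sqrt V.
rewrite (_ : _ - _ = (x * v i - y * u i) ^+ 2) ?sqr_ge0//; ring.
Qed.

Lemma ler_sum_fsubset (R : numDomainType) (K : choiceType) (X Y : {fset K})
    (E : K -> R) :
  (forall x, 0 <= E x) -> (X `<=` Y)%fset ->
  \sum_(x <- X) E x <= \sum_(x <- Y) E x.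
Proof.
move=> E0 XY; rewrite [leRHS](big_fsetID _ (fun x => x \in X))/=.
have -> : [fset x in Y | x \in X]%fset = X.
  apply/fsetP => x; rewrite !inE/= andbC; case: (boolP (x \in X)) => //= xX.
  exact: (fsubsetP XY).
by rewrite lerDl sumr_ge0.
Qed.

(** Group the terms by the value of [h]. The bound [M] is asked only on the
    fibres of positive weight, since the others contribute nothing. *)
Lemma ler_sum_fibers (R : numDomainType) (I K : choiceType) (F : {fset I})
    (h : I -> K) (H : K -> R) (G : I -> R) (M : R) :
  (forall k, 0 <= H k) ->
  (forall k, H k != 0 -> \sum_(i <- F | h i == k) G i <= M) ->
  \sum_(i <- F) H (h i) * G i <= M * \sum_(k <- [fset h i | i in F]%fset) H k.
Proof.
move=> H0 GM; rewrite (partition_big_imfset _ h)/= mulr_sumr ler_sum// => k _.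
under eq_bigr => i /eqP -> do [].
rewrite -mulr_sumr mulrC; have [->|Hk] := eqVneq (H k) 0; first by rewrite !mulr0.
by rewrite ler_wpM2r// GM.
Qed.

Lemma sum_comp_inj_on (R : nmodType) (I K : choiceType) (F : {fset I})
    (P : pred I) (h : I -> K) (E : K -> R) :
  {in [pred i | P i] &, injective h} ->
  \sum_(i <- F | P i) E (h i) =
  \sum_(k <- [fset h i | i in [fset i in F | P i]%fset]%fset) E k.
Proof.
move=> hinj; rewrite big_imfset/= ?big_fset//.
by move=> i j; rewrite !inE/= => /andP[_ Pi] /andP[_ Pj]; exact: hinj.
Qed.

(** * Sequences of weak type *)

(** Weak type [p] with the constant [N], phrased through the finite subsets of
    the level sets [f >= t]: this is the only form in which cardinalities of
    level sets are used below. *)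
Definition weak_bound {R : realType} {K : choiceType} (N p : R) (f : K -> R) :=
  forall (t : R) (X : {fset K}), 0 < t -> (forall x, x \in X -> t <= f x) ->
    (#|` X|)%:R <= N * t `^ (- p).

(** The solution [D] of [2^(2-p) D + 4 N = D], the equation that closes the
    induction on dyadic levels in [sum_sqr_tail]. *)
Definition tail_const {R : realType} (N p : R) : R := 4 * N / (1 - 2 `^ (2 - p)).

Lemma ltr_two_powR1 (R : realType) (x : R) : x < 0 -> 2 `^ x < 1.
Proof.
move=> x0; rewrite /powR pnatr_eq0/= expR_lt1 nmulr_rlt0// ln_gt0//; lra.
Qed.

Lemma tail_const_ge0 (R : realType) (K : choiceType) (f : K -> R) (N p : R) :
  2 < p -> weak_bound N p f -> 0 <= tail_const N p.
Proof.
move=> p2 fN.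
have N0 : 0 <= N.
  by have := fN 1 fset0 ltr01; rewrite cardfs0 powR1 mulr1; apply => x; rewrite inE.
by rewrite divr_ge0 ?mulr_ge0// subr_ge0 ltW// ltr_two_powR1//; lra.
Qed.

(** Write [S t] for the left-hand side. The layer [t <= f < 2 t] contains at
    most [N t^(-p)] points, each contributing at most [4 t^2], whence
    [S t <= S (2 t) + 4 N t^(2-p)]. Since [S] vanishes above the maximum of [f]
    on the finite set [X], iterating gives a geometric series of ratio
    [2^(2-p) < 1]; this is where [2 < p] is needed. *)
Lemma sum_sqr_tail (R : realType) (K : choiceType) (f : K -> R) (N p : R)
    (X : {fset K}) (t : R) :
  2 < p -> (forall k, 0 <= f k) -> weak_bound N p f -> 0 < t ->
  \sum_(x <- X | t <= f x) f x ^+ 2 <= tail_const N p * t `^ (2 - p).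
Proof.
move=> p2 f0 fN.
have q1 : 2 `^ (2 - p) < 1 by apply: ltr_two_powR1; lra.
have D0 := tail_const_ge0 _ _ _ _ _ p2 fN.
have [n] : exists n : nat, forall x, x \in X -> f x < n%:R.
  exists (\max_(x <- X) (Num.truncn (f x)).+1)%N => x xX.
  apply: (lt_le_trans (truncnS_gt _)); rewrite ler_nat.
  exact: (leq_bigmax_seq (F := fun x => (Num.truncn (f x)).+1)).
move=> Xn t0.
(* [m] doublings of [t] suffice to pass above all the values of [f] on [X]. *)
have [m] : exists m : nat, n%:R <= 2 ^+ m * t.
  exists (Num.truncn (n%:R / t)).+1; rewrite -ler_pdivrMr//.
  apply: (le_trans (ltW (truncnS_gt _))).
  by rewrite -natrX ler_nat ltnW// ltn_expl.
elim: m t t0 => [|m IHm] t t0 nt.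
  rewrite big_seq_cond big_pred0 ?(mulr_ge0 D0 (powR_ge0 _ _))// => x.
  apply/negP => /andP[/Xn xn tx]; move: nt; rewrite expr0 mul1r; lra.
have {}IHm : \sum_(x <- X | 2 * t <= f x) f x ^+ 2 <=
    tail_const N p * (2 * t) `^ (2 - p).
  by apply: IHm; [lra|rewrite mulrA -exprSr].
have layer : \sum_(x <- X | (t <= f x) && ~~ (2 * t <= f x)) f x ^+ 2 <=
    4 * N * t `^ (2 - p).
  apply: (@le_trans _ _ (\sum_(x <- [fset x in X | t <= f x]%fset) 4 * t ^+ 2)).
    rewrite [leRHS]big_fset/= [leRHS](bigID (fun x => 2 * t <= f x))/=.
    rewrite -[leLHS]add0r lerD//.
      by apply: sumr_ge0 => x _; rewrite mulr_ge0// sqr_ge0.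
    apply: ler_sum => x /andP[tx]; rewrite -ltNge => xt.
    rewrite (_ : 4 * t ^+ 2 = (2 * t) ^+ 2); last by ring.
    by rewrite ler_sqr ?nnegrE ?f0 ?ltW// mulr_gt0.
  rewrite big_const_seq count_predT iter_addr_0 -[leLHS]mulr_natr.
  rewrite powRD ?(gt_eqF t0) ?implybT// powR_mulrn ?(ltW t0)//.
  rewrite [leRHS](_ : _ = 4 * t ^+ 2 * (N * t `^ (- p))); last by ring.
  rewrite ler_wpM2l ?(mulr_ge0 _ (sqr_ge0 _))//.
  by apply: fN => // x; rewrite !inE/= => /andP[].
rewrite (bigID (fun x => 2 * t <= f x))/=.
rewrite (eq_bigl (fun x => 2 * t <= f x)); last first.
  by move=> x; case: (boolP (2 * t <= f x)) => tx; rewrite ?andbF// andbT; lra.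
apply: (le_trans (lerD IHm layer)); rewrite powRM ?(ltW t0)//.
rewrite [tail_const N p * (_ * _)]mulrA -mulrDl ler_wpM2r ?powR_ge0//.
rewrite -lerBrDl -{1}[tail_const N p]mulr1 -mulrBr.
by rewrite /tail_const divfK// subr_eq0 gt_eqF.
Qed.

(** * The trilinear form on finite sets *)

Definition ell2_fsum {R : realType} {K : choiceType} (X : {fset K}) (A : K -> R) : R :=
  Num.sqrt (\sum_(x <- X) A x ^+ 2).

Definition jointly_injective {I K : Type} (a b : I -> K) :=
  forall i j, a i = a j -> b i = b j -> i = j.

(** For a fixed value of [a] the map [b] is injective, so the corresponding
    fibre sum of [B^2] is at most the whole sum of [B^2]. *)
Lemma sum_sqr_pair (R : realType) (I K : choiceType) (a b : I -> K)
    (A B : K -> R) (F : {fset I}) :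
  jointly_injective a b ->
  \sum_(i <- F) (A (a i) * B (b i)) ^+ 2 <=
    (\sum_(x <- [fset a i | i in F]%fset) A x ^+ 2) *
    (\sum_(y <- [fset b i | i in F]%fset) B y ^+ 2).
Proof.
move=> ab; rewrite mulrC; under eq_bigr do rewrite exprMn.
apply: ler_sum_fibers => [x|x _]; first exact: sqr_ge0.
rewrite (sum_comp_inj_on _ _ _ _ _ _ (fun y => B y ^+ 2)).
  apply: ler_sum_fsubset => [y|]; first exact: sqr_ge0.
  apply/fsubsetP => y /imfsetP[i]; rewrite !inE/= => /andP[iF _] ->.
  exact: in_imfset.
by move=> i j; rewrite !inE => /eqP ai /eqP aj; apply: ab; rewrite ai aj.
Qed.

(** On the fibre [c = z] the values of [f] are at least [g z `^ (q / p)], so the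
    tail estimate applies to [f] at that level; the relation between the
    exponents makes the resulting power of [g z] cancel the factor
    [g z ^+ 2]. *)
Lemma sum_sqr_kernel (R : realType) (I K : choiceType) (b c : I -> K)
    (f g C : K -> R) (N p q : R) (F : {fset I}) :
  2 < p -> 2 < q -> 1 / p + 1 / q = 1 / 2 ->
  (forall k, 0 <= f k) -> (forall k, 0 <= g k) -> weak_bound N p f ->
  jointly_injective b c ->
  (forall i, i \in F -> g (c i) `^ q <= f (b i) `^ p) ->
  \sum_(i <- F) (f (b i) * g (c i) * C (c i)) ^+ 2 <=
    tail_const N p * \sum_(z <- [fset c i | i in F]%fset) C z ^+ 2.
Proof.
move=> p2 q2 pq f0 g0 fN bc gf.
rewrite (eq_bigr (fun i => C (c i) ^+ 2 * (f (b i) ^+ 2 * g (c i) ^+ 2))); last first.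
  by move=> i _; ring.
apply: ler_sum_fibers => [z|z _]; first exact: sqr_ge0.
rewrite (eq_bigr (fun i => f (b i) ^+ 2 * g z ^+ 2)); last by move=> i /eqP ->.
rewrite -mulr_suml.
have [->|gz] := eqVneq (g z) 0.
  by rewrite expr0n mulr0; exact: (tail_const_ge0 _ _ _ _ _ p2 fN).
have {}gz : 0 < g z by rewrite lt_def gz g0.
rewrite (sum_comp_inj_on _ _ _ _ _ _ (fun x => f x ^+ 2)); last first.
  by move=> i j; rewrite !inE => /eqP ci /eqP cj /bc; apply; rewrite ci cj.
set X := imfset _ _ _.
have Xt x : x \in X -> g z `^ (q / p) <= f x.
  move=> /imfsetP[i]; rewrite !inE/= => /andP[iF /eqP ci] ->.
  have p_neq0 : p != 0 by rewrite gt_eqF//; lra.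
  rewrite -[leRHS]powRr1// -(divff p_neq0) powRrM [leRHS]powRrM.
  apply: ge0_ler_powR; rewrite ?nnegrE ?powR_ge0 ?invr_ge0//; first lra.
  by rewrite -ci gf.
have t0 : 0 < g z `^ (q / p) by rewrite powR_gt0.
have := sum_sqr_tail _ _ _ _ _ X _ p2 f0 fN t0.
rewrite big_seq_cond (eq_bigl (fun x => x \in X)) => [|x]; last first.
  by apply: andb_idr; exact: Xt.
rewrite -big_seq -powRrM => tail.
(* This is where the scaling relation between [p] and [q] enters. *)
have E : q / p * (2 - p) = - 2%:R.
  have p_neq0 : p != 0 by rewrite gt_eqF//; lra.
  have q_neq0 : q != 0 by rewrite gt_eqF//; lra.
  transitivity (q * (2 * (1 / p) - 1)); first by field.
  have -> : 1 / p = 1 / 2 - 1 / q by lra.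
  by field.
rewrite E powR_invn ?(ltW gz)// in tail.
by rewrite -ler_pdivlMr ?exprn_gt0.
Qed.

(** Cauchy-Schwarz for the splitting into [A(a) B(b)] and [f(b) g(c) C(c)]; the
    weight [C] is attached to the kernel because the region controls the sum of
    [f^2] along the fibres of [c]. *)
Lemma sum_half_region (R : realType) (I K : choiceType) (a b c : I -> K)
    (f g A B C : K -> R) (N p q : R) (F : {fset I}) :
  2 < p -> 2 < q -> 1 / p + 1 / q = 1 / 2 ->
  (forall k, 0 <= f k) -> (forall k, 0 <= g k) -> weak_bound N p f ->
  jointly_injective a b -> jointly_injective b c ->
  (forall i, i \in F -> g (c i) `^ q <= f (b i) `^ p) ->
  \sum_(i <- F) f (b i) * g (c i) * A (a i) * B (b i) * C (c i) <=
    Num.sqrt (tail_const N p) *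
    (ell2_fsum [fset a i | i in F]%fset A * ell2_fsum [fset b i | i in F]%fset B *
     ell2_fsum [fset c i | i in F]%fset C).
Proof.
move=> p2 q2 pq f0 g0 fN ab bc gf.
rewrite (eq_bigr (fun i => (A (a i) * B (b i)) *
  (f (b i) * g (c i) * C (c i)))); last by move=> i _; ring.
apply: (le_trans (cauchy_schwarz_sum _ _ _ _ _ _)).
rewrite [leRHS]mulrCA /ell2_fsum.
rewrite -[X in _ <= X * _]sqrtrM; last by apply: sumr_ge0 => x _; exact: sqr_ge0.
rewrite -[X in _ <= _ * X]sqrtrM; last exact: (tail_const_ge0 _ _ _ _ _ p2 fN).
apply: ler_pM; rewrite ?sqrtr_ge0// ler_wsqrtr//.
  exact: sum_sqr_pair.
exact: sum_sqr_kernel pq f0 g0 fN bc gf.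
Qed.

Lemma ell2_fsum_ge0 (R : realType) (K : choiceType) (X : {fset K}) (A : K -> R) :
  0 <= ell2_fsum X A.
Proof. exact: sqrtr_ge0. Qed.

Lemma ler_ell2_fsum (R : realType) (K : choiceType) (X Y : {fset K})
    (A : K -> R) : (X `<=` Y)%fset -> ell2_fsum X A <= ell2_fsum Y A.
Proof.
by move=> XY; apply: ler_wsqrtr; apply: ler_sum_fsubset => // x; exact: sqr_ge0.
Qed.

(** * Passage to infinite sums *)

Lemma ell2_fsum_le_norm (R : realType) (K : countType) (X : {fset K}) (A : K -> R) :
  ((ell2_fsum X A)%:E <= ell2_norm A)%E.
Proof.
rewrite /ell2_norm /ell2_fsum.
have S0 : 0 <= \sum_(x <- X) A x ^+ 2 by apply: sumr_ge0 => x _; exact: sqr_ge0.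
rewrite -powR12_sqrt// -poweR_EFin; apply: gt0_ler_poweR; rewrite ?invr_ge0//.
- by rewrite in_itv/= lee_fin S0 leey.
- rewrite in_itv/= leey andbT; apply: esum_ge0 => x _.
  by rewrite lee_fin sqr_ge0.
apply: esum_ge; exists [set` X]; first by split.
rewrite fsbig_finite//= set_fsetK -sumEFin.
by under [leRHS]eq_bigr do rewrite real_normK ?num_real//.
Qed.

(** The quasi-norm counts the strict level sets [f > t], while [weak_bound]
    counts the sets [f >= t]; applying the former at [t / 2] costs the factor
    2 in the constant. *)
Lemma weak_ell_bound (R : realType) (K : countType) (p : R) (f : K -> R) :
  0 < p -> (forall k, 0 <= f k) -> weak_ell p f -> exists N, weak_bound N p f.
Proof.
move=> p0 f0; rewrite /weak_ell/= /weak_ell_norm.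
set M := ereal_sup _ => Moo.
have M0 : (0 <= M)%E.
  apply: le_trans (ereal_sup_ubound _) => /=; last by exists 1; [exact: ltr01|].
  by rewrite mul1e poweR_ge0.
have MfinE : M = (fine M)%:E by rewrite fineK// ge0_fin_numE.
exists ((2 * fine M) `^ p) => t X t0 Xt.
set S := [set k | t / 2 < `|f k|].
have t20 : 0 < t / 2 by rewrite divr_gt0.
have XS : [set` X] `<=` S.
  move=> x /= /Xt tx; rewrite /S/= ger0_norm//; apply: lt_le_trans tx; lra.
have : ((t / 2)%:E * counting S `^ p^-1 <= M)%E.
  by apply: ereal_sup_ubound => /=; exists (t / 2).
rewrite /counting; case: ifPn => [/asboolP finS|_].
  rewrite [leRHS]MfinE poweR_EFin -EFinM lee_fin => SM.
  have XSn : (#|` X|)%:R <= (#|` fset_set S|)%:R :> R.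
    rewrite ler_nat fsubset_leq_card//; apply/fsubsetP => x xX.
    by rewrite in_fset_set// inE; exact: XS.
  apply: (le_trans XSn); set n : R := _%:R in SM XSn *.
  have n0 : 0 <= n by rewrite ler0n.
  rewrite powRN ler_pdivlMr ?powR_gt0//.
  have p_neq0 : p != 0 by rewrite gt_eqF.
  rewrite -[n in leLHS](powRr1 n0) -[X in n `^ X](mulVf p_neq0) powRrM.
  rewrite -powRM ?powR_ge0 ?(ltW t0)//.
  have m0 : 0 <= fine M by rewrite fine_ge0.
  apply: ge0_ler_powR;
    rewrite ?nnegrE ?mulr_ge0 ?powR_ge0 ?(ltW t0) ?(ltW p0)//; lra.
rewrite poweRyr ?invr_neq0 ?gt_eqF// gt0_muley ?lte_fin// leye_eq => /eqP Mty.
by rewrite Mty in Moo.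
Qed.

(** The abstract form of the inequality: nothing is known of the index set
    except that any two of the three maps separate its points. *)
Lemma esum_trilinear (R : realType) (I K : countType) (a b c : I -> K)
    (f g : K -> R) (p q : R) :
  2 < p -> 2 < q -> 1 / p + 1 / q = 1 / 2 ->
  (forall k, 0 <= f k) -> (forall k, 0 <= g k) ->
  weak_ell p f -> weak_ell q g ->
  jointly_injective a b -> jointly_injective b c -> jointly_injective a c ->
  exists M : R, 0 < M /\ forall A B C : K -> R,
    (\esum_(i in [set: I])
       (f (b i) * g (c i) * A (a i) * B (b i) * C (c i))%:E <=
     M%:E * (ell2_norm A * ell2_norm B * ell2_norm C))%E.
Proof.
move=> p2 q2 pq f0 g0 wf wg ab bc ac.
have [N fN] : exists N, weak_bound N p f by apply: weak_ell_bound => //; lra.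
have [N' gN] : exists N, weak_bound N q g by apply: weak_ell_bound => //; lra.
set M := Num.sqrt (tail_const N p) + Num.sqrt (tail_const N' q).
have M0 : 0 <= M by rewrite addr_ge0 ?sqrtr_ge0.
(* [M] may vanish, for instance when [f = g = 0], and the constant has to be
   positive. *)
exists (M + 1); split=> [|A B C]; first by rewrite ltr_wpDl.
apply: ge_ereal_sup => _ [F [finF _] <-].
rewrite fsbig_finite//= sumEFin; set X := fset_set F.
set l := ell2_fsum [fset a i | i in X]%fset A *
  ell2_fsum [fset b i | i in X]%fset B * ell2_fsum [fset c i | i in X]%fset C.
have l0 : 0 <= l by rewrite !mulr_ge0 ?ell2_fsum_ge0.
apply: (@le_trans _ _ ((M + 1) * l)%:E); last first.
  rewrite !EFinM lee_pmul ?lee_fin ?mulr_ge0 ?ell2_fsum_ge0 ?addr_ge0//.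
  by rewrite !lee_pmul ?lee_fin ?mulr_ge0 ?ell2_fsum_ge0 ?ell2_fsum_le_norm.
rewrite lee_fin; apply: (@le_trans _ _ (M * l)); last first.
  by rewrite ler_wpM2r// lerDl.
have image_sub (h : I -> K) (P : pred I) :
    ([fset h i | i in [fset i in X | P i]] `<=` [fset h i | i in X])%fset.
  apply/fsubsetP => k /imfsetP[i]; rewrite !inE/= => /andP[iX _] ->.
  exact: in_imfset.
rewrite (big_fsetID _ (fun i => g (c i) `^ q <= f (b i) `^ p))/= mulrDl.
apply: lerD.
  apply: (@le_trans _ _ _ _ _ (sum_half_region _ _ _ _ _ _ _ _ A B C _ _ _ _
    p2 q2 pq f0 g0 fN ab bc _)).
    by move=> i; rewrite !inE/= => /andP[].
  rewrite ler_wpM2l ?sqrtr_ge0// !ler_pM ?mulr_ge0 ?ell2_fsum_ge0//;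
    exact: ler_ell2_fsum.
(* On the complement [f(b)^p < g(c)^q]: exchange [(f, b, B)] and [(g, c, C)]. *)
rewrite addrC in pq.
have cb : jointly_injective c b by move=> i j ci bi; exact: bc.
rewrite (eq_bigr (fun i => g (c i) * f (b i) * A (a i) * C (c i) * B (b i)));
  last by move=> i _; ring.
apply: (@le_trans _ _ _ _ _ (sum_half_region _ _ _ _ _ _ _ _ A C B _ _ _ _
  q2 p2 pq g0 f0 gN ac cb _)).
  by move=> i; rewrite !inE/= => /andP[_]; rewrite -ltNge => /ltW.
rewrite ler_wpM2l ?sqrtr_ge0// mulrAC !ler_pM ?mulr_ge0 ?ell2_fsum_ge0//;
  exact: ler_ell2_fsum.
Qed.

Theorem proposition3p3 (R : realType) (d : nat) (p1 p2 : R)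
    (hp1 : 2 < p1) (hp2 : 2 < p2) (hp : 1 / p1 + 1 / p2 = 1 / 2)
    (f1 f2 : lattice d -> R)
    (hf1 : weak_ell p1 f1) (hf2 : weak_ell p2 f2)
    (f1_ge0 : forall nu, 0 <= f1 nu) (f2_ge0 : forall nu, 0 <= f2 nu) :
  [/\ class_B (fun nu : lattice d * lattice d => f1 nu.1 * f2 nu.2),
      class_B (fun nu : lattice d * lattice d => f1 (nu.1 + nu.2) * f2 nu.2) &
      class_B (fun nu : lattice d * lattice d => f1 nu.1 * f2 (nu.1 + nu.2))].
Proof.
pose I := (lattice d * lattice d)%type.
have inj12 : jointly_injective (fun nu : I => nu.1) (fun nu => nu.2).
  by move=> [x y] [x' y'] /= -> ->.
have injs1 : jointly_injective (fun nu : I => nu.1 + nu.2) (fun nu => nu.1).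
  by move=> [x y] [x' y'] /= + xx'; rewrite xx' => /addrI ->.
have injs2 : jointly_injective (fun nu : I => nu.1 + nu.2) (fun nu => nu.2).
  by move=> [x y] [x' y'] /= + yy'; rewrite yy' => /addIr ->.
have injC (a b : I -> lattice d) : jointly_injective a b -> jointly_injective b a.
  by move=> ab i j bij aij; exact: ab.
(* In the second and third products the weights [f1], [f2] sit on other maps
   than [nu.1], [nu.2], so [a] is the remaining map and [A], [B], [C] are
   permuted accordingly. *)
split; split; try by move=> nu; rewrite mulr_ge0.
- have [M [M0 HM]] := esum_trilinear _ _ _ _ _ _ _ _ _ _ hp1 hp2 hp f1_ge0 f2_ge0
    hf1 hf2 injs1 inj12 injs2.
  exists M; split=> // A B C A0 B0 C0; rewrite -!muleA.
  by apply: le_trans (HM A B C) _; rewrite !muleA.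
- have [M [M0 HM]] := esum_trilinear _ _ _ _ _ _ _ _ _ _ hp1 hp2 hp f1_ge0 f2_ge0
    hf1 hf2 (injC _ _ injs1) injs2 inj12.
  exists M; split=> // A B C A0 B0 C0.
  have := HM B A C.
  congr (_ <= _)%E.
    by apply: eq_esum => nu _; congr EFin; ring.
  by rewrite !muleA; congr (_ * _)%E; rewrite muleAC.
- have [M [M0 HM]] := esum_trilinear _ _ _ _ _ _ _ _ _ _ hp1 hp2 hp f1_ge0 f2_ge0
    hf1 hf2 (injC _ _ inj12) (injC _ _ injs1) (injC _ _ injs2).
  exists M; split=> // A B C A0 B0 C0.
  have := HM C B A.
  congr (_ <= _)%E.
    by apply: eq_esum => nu _; congr EFin; ring.
  rewrite -!muleA; congr (_ * _)%E.
  by rewrite muleC -muleA muleCA.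
Qed.
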